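(* Let $(X,d)$ be a metric space, $f:X\to X$ a continuous map, and $n\in\mathbb{N}$ with $n\geq 2$. If $(X,f)$ is thickly syndetically $n$-sensitive, then $(X,f)$ is semi-strongly $\beta$-$n$-sensitive, i.e. $(X,f)$ is $\beta$-$n$-sensitive for every $\beta\in\mathbb{N}^n$.
   Context: $\mathbb{N}=\{1,2,3,\dots\}$. A set $A\subseteq\mathbb{N}$ is syndetic if there is a positive integer $M$ with $\{i,i+1,\dots,i+M\}\cap A\neq\emptyset$ for every $i\in\mathbb{N}$; it is thickly syndetic if for every $l\in\mathbb{N}$ the set $\{m\in\mathbb{N}: m+j\in A \text{ for } 0\leq j\leq l\}$ is syndetic. - $(X,f)$ is thickly syndetically $n$-sensitive if there is $\delta>0$ such that for every nonempty open $U\subseteq X$ the set $\{k\in\mathbb{N}:\exists x_1,\dots,x_n\in U \text{ with } \min_{1\le i<j\le n}d(f^k(x_i),f^k(x_j))>\delta\}$ is thickly syndetic. - For $\beta=(m_1,\dots,m_n)\in\mathbb{N}^n$, $(X,f)$ is $\beta$-$n$-sensitive if there is $\delta>0$ such that for every nonempty open $U\subseteq X$ there are $k\in\mathbb{N}$ and $x_1,\dots,x_n\in U$ with $\min_{1\leq i<j\leq n}d(f^{m_ik}(x_i),f^{m_jk}(x_j))>\delta$. *)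

(* Defs.v *)
From HB Require Import structures.
From mathcomp Require Import all_boot all_order all_algebra.
From mathcomp Require Import all_classical all_reals all_analysis.

Set Implicit Arguments.
Unset Strict Implicit.
Unset Printing Implicit Defensive.

Import Order.TTheory GRing.Theory Num.Theory.

Local Open Scope classical_set_scope.
Local Open Scope ring_scope.

(* The natural numbers are {1, 2, 3, ...} here: a subset of them is a [set nat]
   and positivity is required explicitly of every quantified natural number. *)

Definition syndetic (A : set nat) : Prop :=
  exists2 M : nat, (0 < M)%N &
    forall i : nat, (0 < i)%N ->
      [set k | (i <= k <= i + M)%N] `&` A !=set0.

Definition thickly_syndetic (A : set nat) : Prop :=
  forall l : nat, (0 < l)%N ->
    syndetic [set m | (0 < m)%N /\ forall j : nat, (j <= l)%N -> A (m + j)%N].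

(* min_{1 <= i < j <= n} d(y_i, y_j). The neutral element +oo is the value of
   the empty minimum only (n < 2): every distance is finite. *)
Definition min_dist (R : realType) (X : metricType R) (n : nat)
    (y : 'I_n -> X) : \bar R :=
  \big[Order.min/+oo%E]_(p : 'I_n * 'I_n | (p.1 < p.2)%N)
    (mdist (y p.1) (y p.2))%:E.

Definition separation_times (R : realType) (X : metricType R) (f : X -> X)
    (n : nat) (delta : R) (U : set X) : set nat :=
  [set k | (0 < k)%N /\
    exists x : 'I_n -> X, (forall i, U (x i)) /\
      (delta%:E < min_dist (fun i => iter k f (x i)))%E].

Definition thickly_syndetically_sensitive (R : realType) (X : metricType R)
    (f : X -> X) (n : nat) : Prop :=
  exists2 delta : R, 0 < delta &
    forall U : set X, open U -> U !=set0 ->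
      thickly_syndetic (separation_times f n delta U).

Definition beta_sensitive (R : realType) (X : metricType R)
    (f : X -> X) (n : nat) (beta : 'I_n -> nat) : Prop :=
  exists2 delta : R, 0 < delta &
    forall U : set X, open U -> U !=set0 ->
      exists2 k : nat, (0 < k)%N &
        exists x : 'I_n -> X, (forall i, U (x i)) /\
          (delta%:E < min_dist (fun i => iter (beta i * k) f (x i)))%E.

Definition semi_strongly_beta_sensitive (R : realType) (X : metricType R)
    (f : X -> X) (n : nat) : Prop :=
  forall beta : 'I_n -> nat, (forall i, (0 < beta i)%N) ->
    beta_sensitive f beta.

(* Main.v *)
(* Given an open set U with separation times A, thick syndeticity yields a
   single k with [beta i * k] in A for all i.  At each time [beta i * k], U then
   contains n points whose images are more than delta apart, so the image of a
   previously chosen point is within delta/2 of at most one of them.  As fewer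
   than n points precede the i-th one, it can be chosen greedily. *)
Require Import Defs.
From HB Require Import structures.
From mathcomp Require Import all_boot all_order all_algebra.
From mathcomp Require Import all_classical all_reals all_analysis.
From mathcomp Require Import zify lra.

Set Implicit Arguments.
Unset Strict Implicit.
Unset Printing Implicit Defensive.

Import Order.TTheory GRing.Theory Num.Theory.

Local Open Scope classical_set_scope.
Local Open Scope ring_scope.

(** A run [b, ..., b + l + M] in [B] has room for a run [a, ..., a + l] in [A], since one starts
    within [M] of [b]. *)
Lemma thickly_syndeticI (A B : set nat) :
  thickly_syndetic A -> thickly_syndetic B -> thickly_syndetic (A `&` B).
Proof.
move=> tA tB l l_gt0; have [M M_gt0 synA] := tA l l_gt0.
have [|N N_gt0 synB] := tB (l + M)%N; first by lia.
exists (N + M)%N; first by lia.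
move=> i i_gt0; have [b /= [/andP[ib bN] [b_gt0 Bb]]] := synB i i_gt0.
have [a /= [/andP[ba aM] [a_gt0 Aa]]] := synA b b_gt0.
exists a; split=> /=; first by lia.
split=> // j jl; split; first exact: Aa.
have -> : (a + j = b + (a - b + j))%N by lia.
by apply: Bb; lia.
Qed.

(** A run [a, ..., a + m * l.+1] in [A] contains [l.+1] consecutive multiples of [m], starting with
    [m * (a %/ m).+1]. *)
Lemma thickly_syndetic_preimage_muln (m : nat) (A : set nat) : (0 < m)%N ->
  thickly_syndetic A -> thickly_syndetic [set k | A (m * k)%N].
Proof.
move=> m_gt0 tA l l_gt0; have [|M M_gt0 synA] := tA (m * l.+1)%N.
  by rewrite muln_gt0 m_gt0.
(* Searching from [m * i] makes [a %/ m] at least [i]; the successor in [M.+1] pays for rounding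
   up. *)
exists M.+1 => // i i_gt0; have [|a /= [/andP[ia aM] [a_gt0 Aa]]] := synA (m * i)%N.
  by rewrite muln_gt0 m_gt0.
have aE := divn_eq a m; have r_lt := ltn_pmod a m_gt0.
have iq : (i <= a %/ m)%N by rewrite leq_divRL // mulnC.
have qM : (a %/ m <= i + M)%N.
  by rewrite -ltnS ltn_divLR //; nia.
exists (a %/ m).+1; split=> /=; first by lia.
split=> // j jl.
have -> : (m * ((a %/ m).+1 + j) = a + (m * ((a %/ m).+1 + j) - a))%N by nia.
by apply: Aa; nia.
Qed.

Lemma thickly_syndetic_multiples (A : set nat) (s : seq nat) :
  thickly_syndetic A -> all (leq 1) s ->
  thickly_syndetic [set k | forall m, m \in s -> A (m * k)%N].
Proof.
move=> tA; elim: s => [_ l _|m s IHs /= /andP[m_gt0 s_gt0]].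
  by exists 1%N => // i i_gt0; exists i; split=> /=; [lia | split].
have -> : [set k | forall m', m' \in m :: s -> A (m' * k)%N] =
    [set k | A (m * k)%N] `&` [set k | forall m', m' \in s -> A (m' * k)%N].
  apply/seteqP; split=> k /=.
    by move=> H; split=> [|m' m's]; apply: H; rewrite inE ?eqxx ?m's ?orbT.
  by case=> Am As m'; rewrite inE => /predU1P[->|/As].
by apply: thickly_syndeticI (IHs s_gt0); apply: thickly_syndetic_preimage_muln.
Qed.

Lemma lt_min_distP (R : realType) (X : metricType R) (n : nat) (y : 'I_n -> X)
    (delta : R) :
  (delta%:E < min_dist y)%E <->
  forall i j : 'I_n, (i < j)%N -> delta < mdist (y i) (y j).
Proof.
rewrite /min_dist; split=> [/bigmin_gtP[_ H] i j ij|H].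
  by rewrite -lte_fin; apply: (H (i, j)).
by apply/bigmin_gtP; split=> [|[i j] /= ij]; rewrite ?ltry // lte_fin H.
Qed.

(** Row [i] of [g] lists the candidates for the [i]-th point, and [c i] is the column chosen in
    it. *)
Lemma greedy_separated_choice (R : realType) (X : metricType R) (n : nat)
    (g : 'I_n -> 'I_n -> X) (delta : R) :
  (forall i j j' : 'I_n, (j < j')%N -> delta < mdist (g i j) (g i j')) ->
  exists c : 'I_n -> 'I_n, forall i j : 'I_n, (i < j)%N ->
    delta / 2 < mdist (g i (c i)) (g j (c j)).
Proof.
(* Induction on the number [p] of rows settled; [c] is arbitrary from row [p] on. *)
move=> sep; suff H p : (p <= n)%N -> exists c : 'I_n -> 'I_n,
    forall i j : 'I_n, (i < j)%N -> (j < p)%N ->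
    delta / 2 < mdist (g i (c i)) (g j (c j)).
  by have [c Hc] := H n (leqnn n); exists c => i j ij; apply: Hc.
elim: p => [_|p IHp pn]; first by exists id.
have [c Hc] := IHp (ltnW pn); pose q := Ordinal pn.
have [a Ha] : exists a, forall i : 'I_n, (i < p)%N ->
    delta / 2 < mdist (g i (c i)) (g q a).
  (* Otherwise each candidate [a] is blocked by an earlier row [h a]. A row blocking two candidates
     would put them within [delta] of each other, so [h] is injective. *)
  apply: contrapT => /forallNP noa.
  have /choice[h Hh] a : exists i : 'I_n, (i < p)%N /\
      mdist (g i (c i)) (g q a) <= delta / 2.
    have /existsNP[i /not_implyP[ip /negP]] := noa a.
    by rewrite -leNgt; exists i.
  have h_neq (a a' : 'I_n) : (a < a')%N -> h a <> h a'.
    move=> aa' haa'; have [_ da] := Hh a; have [_ da'] := Hh a'.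
    rewrite haa' in da; have := sep q a a' aa'.
    have := metric_triangle (g q a) (g (h a') (c (h a'))) (g q a').
    by rewrite (metric_sym (g q a) (g (h a') _)); lra.
  have h_inj : injective h.
    move=> a a' haa'; apply: val_inj; case: (ltngtP a a') => //.
      by move/h_neq.
    by move/h_neq => /(_ (esym haa')).
  (* An injection of ['I_n] into itself is onto, so [h] attains [q], although all its values are
     below [p]. *)
  have [h' _ h'K] := injF_bij h_inj.
  by have [] := Hh (h' q); rewrite h'K ltnn.
exists (fun i => if i == q then a else c i) => i j ij jp.
have /negPf-> : i != q by rewrite -val_eqE /=; lia.
case: eqVneq => [jq|]; first by rewrite jq; apply: Ha; rewrite jq in ij.
by rewrite -val_eqE /= => jq; apply: Hc => //; lia.
Qed.

Theorem theorem6 (R : realType) (X : metricType R) (f : X -> X) (n : nat) :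
  continuous f -> (2 <= n)%N ->
  thickly_syndetically_sensitive f n ->
  semi_strongly_beta_sensitive f n.
Proof.
move=> _ _ [delta delta_gt0 sens] beta beta_gt0.
exists (delta / 2) => [|U Uo U0]; first by rewrite divr_gt0.
have betas_gt0 : all (leq 1) (codom beta) by apply/allP => _ /codomP[i ->].
(* A single [k] suffices: take [l = 1] and [i = 1], then [j = 0] in the run found. *)
have /(_ 1%N isT)[M _ /(_ 1%N isT)] :=
  thickly_syndetic_multiples (sens U Uo U0) betas_gt0.
case=> k [_ [k_gt0 /(_ 0%N isT) /=]]; rewrite addn0 => Hk.
exists k => //.
have /choice[x Hx] i : exists y : 'I_n -> X, (forall j, U (y j)) /\
    (delta%:E < min_dist (fun j => iter (beta i * k) f (y j)))%E.
  by have [] := Hk (beta i) (codom_f beta i).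
(* Row [i] holds the images at time [beta i * k] of the tuple [x i], which is separated at that
   time. *)
have [|c Hc] := @greedy_separated_choice R X n
    (fun i j => iter (beta i * k) f (x i j)) delta.
  by move=> i; apply/lt_min_distP; case: (Hx i).
exists (fun i => x i (c i)); split=> [i|]; first by case: (Hx i).
exact/lt_min_distP.
Qed.
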